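(* Let $L$ be a bounded distributive lattice. Then: 1. $L$ has a meet-complete representation if and only if $L$ has a distinguishing set of complete, prime filters; 2. $L$ has a join-complete representation if and only if $L$ has a distinguishing set of completely-prime filters; 3. $L$ has a complete representation if and only if $L$ has a distinguishing set of complete, completely-prime filters.
   Context: A representation of a bounded distributive lattice $L$ is a lattice embedding $h\colon L\to\wp(X)$ for some set $X$, where $\wp(X)$ is regarded as a ring of sets under union and intersection; representations are assumed irredundant, i.e. for every $x\in X$ there is $a\in L$ with $x\in h(a)$. A lattice map $f\colon L_1\to L_2$ is meet-complete if for all $S\subseteq L_1$ such that $\bigwedge S$ exists in $L_1$ we have $f(\bigwedge_{L_1}S)=\bigwedge_{L_2}f[S]$; join-complete is defined dually; a map is complete if it is both meet-complete and join-complete. A set $S\subseteq\wp(L)$ is distinguishing over $L$ if for every pair $a\neq b$ in $L$ there is $s\in S$ with either $a\in s$ and $b\notin s$, or $b\in s$ and $a\notin s$. A filter $F$ of $L$ is complete if whenever $T\subseteq F$ and $\bigwedge T$ exists in $L$, then $\bigwedge T\in F$. A prime filter $F$ of $L$ is completely prime if whenever $S\subseteq L$, $\bigvee S$ exists and $\bigvee S\in F$, then $F\cap S\neq\emptyset$. Prime filters are nonempty and proper. *)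

(* Defs.v *)
From HB Require Import structures.
From mathcomp Require Import all_boot all_order.
From mathcomp Require Import boolp classical_sets.

Set Implicit Arguments.
Unset Strict Implicit.
Unset Printing Implicit Defensive.

Import Order.TTheory.
Local Open Scope classical_set_scope.

Section CompleteMaps.
Context {d1 d2 : Order.disp_t} {L1 : latticeType d1} {L2 : latticeType d2}.
Implicit Type f : L1 -> L2.

(* [infimums S] (resp. [supremums S]) is the set of greatest lower (resp. least
   upper) bounds of S: it has at most one element, and [infimums S m] reads
   "the meet of S exists and equals m". The empty S is allowed. *)
Definition meet_complete f : Prop :=
  forall (S : set L1) (m : L1), infimums S m -> infimums (f @` S) (f m).

Definition join_complete f : Prop :=
  forall (S : set L1) (m : L1), supremums S m -> supremums (f @` S) (f m).

Definition complete_map f : Prop := meet_complete f /\ join_complete f.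

End CompleteMaps.

Section Representations.
Context {d : Order.disp_t} {L : tbDistrLatticeType d}.

(* [set X] carries the lattice structure of classical_sets: inclusion order,
   intersection as meet and union as join. [{lmorphism _ -> _}] preserves the
   binary operations only; nothing is imposed on the image of [\bot]. *)
Definition representation (X : Type) (h : {lmorphism L -> set X}) : Prop :=
  injective h /\ (forall x : X, exists a : L, h a x).

End Representations.

Definition has_meet_complete_representation (d : Order.disp_t)
    (L : tbDistrLatticeType d) : Prop :=
  exists (X : Type) (h : {lmorphism L -> set X}),
    representation h /\ meet_complete h.

Definition has_join_complete_representation (d : Order.disp_t)
    (L : tbDistrLatticeType d) : Prop :=
  exists (X : Type) (h : {lmorphism L -> set X}),
    representation h /\ join_complete h.

Definition has_complete_representation (d : Order.disp_t)
    (L : tbDistrLatticeType d) : Prop :=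
  exists (X : Type) (h : {lmorphism L -> set X}),
    representation h /\ complete_map h.

Section Filters.
Context {d : Order.disp_t} {L : tbDistrLatticeType d}.
Implicit Type F : set L.

Definition lattice_filter F : Prop :=
  [/\ F !=set0,
      forall a b : L, F a -> (a <= b)%O -> F b
    & forall a b : L, F a -> F b -> F (a `&` b)%O].

Definition prime_filter F : Prop :=
  [/\ lattice_filter F,
      F <> setT
    & forall a b : L, F (a `|` b)%O -> F a \/ F b].

Definition complete_filter F : Prop :=
  lattice_filter F /\
  (forall (T : set L) (m : L), T `<=` F -> infimums T m -> F m).

Definition completely_prime_filter F : Prop :=
  prime_filter F /\
  (forall (S : set L) (m : L), supremums S m -> F m -> F `&` S !=set0).

Definition distinguishing (S : set (set L)) : Prop :=
  forall a b : L, a <> b ->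
    exists2 s, S s & (s a /\ ~ s b) \/ (s b /\ ~ s a).

End Filters.

(* Main.v *)
(** A point x of a representation h yields the filter of those a with x in h(a),
    and h preserves all existing meets (joins) iff all these filters are complete
    (completely prime). Conversely a distinguishing set S of prime filters
    represents L on S by sending a to the set of filters in S containing a; the
    point filters of this representation are the members of S themselves. *)

Require Import Defs.
From HB Require Import structures.
From mathcomp Require Import all_boot all_order.
From mathcomp Require Import boolp classical_sets.

Set Implicit Arguments.
Unset Strict Implicit.
Unset Printing Implicit Defensive.

Import Order.TTheory.
Local Open Scope classical_set_scope.

Section SetLattice.
Context {X : Type}.

(** Turns preservation of a meet into an equation of sets, to be checked point by point; the empty
    family gives the whole of [X]. *)
Lemma infimums_setP (B : set (set X)) (A : set X) :
  infimums B A <-> A = \bigcap_(C in B) C.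
Proof.
split=> [[lbA ubA]|->].
  apply/seteqP; split=> [x Ax C BC|].
    by have /subsetPset := lbA _ BC; exact.
  by apply/subsetPset/ubA => C BC; apply/subsetPset => x; exact.
split=> [C BC|C lbC]; apply/subsetPset; first by move=> x; exact.
by move=> x Cx D BD; have /subsetPset := lbC _ BD; exact.
Qed.

Lemma supremums_setP (B : set (set X)) (A : set X) :
  supremums B A <-> A = \bigcup_(C in B) C.
Proof.
split=> [[ubA lbA]|->].
  apply/seteqP; split=> [|x [C BC Cx]].
    by apply/subsetPset/lbA => C BC; apply/subsetPset => x Cx; exists C.
  by have /subsetPset := ubA _ BC; exact.
split=> [C BC|C ubC]; apply/subsetPset; first by move=> x Cx; exists C.
by move=> x [D BD Dx]; have /subsetPset := ubC _ BD; exact.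
Qed.

End SetLattice.

Section PointFilter.
Context {d : Order.disp_t} {L : tbDistrLatticeType d} {X : Type}.
Variable h : {lmorphism L -> set X}.

Definition point_filter (x : X) : set L := [set a | h a x].

Lemma hom_subset (a b : L) : (a <= b)%O -> h a `<=` h b.
Proof. by move=> ab; apply/subsetPset; exact: omorph_le. Qed.

(** Monotonicity of [h] already puts [h m] inside the intersection of the [h a] for [a] in [T]; the
    converse inclusion, read at a point [x], is the closure condition on the filter of [x]. *)
Lemma meet_completeP :
  meet_complete h <-> forall x (T : set L) (m : L),
    T `<=` point_filter x -> infimums T m -> point_filter x m.
Proof.
split=> [hc x T m TF /hc/infimums_setP|hc T m infTm].
  by rewrite /point_filter /= => -> _ [a /TF hax <-].
apply/infimums_setP/seteqP; split=> x.
  by move=> hmx _ [a Ta <-]; apply: hom_subset hmx; exact: infTm.1.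
by move=> hTx; apply: hc infTm => a Ta; apply: hTx; exists a.
Qed.

(** Dually, monotonicity puts each [h a] inside [h m]; the condition at [x] says that a point of
    [h m] already lies in some [h a]. *)
Lemma join_completeP :
  join_complete h <-> forall x (T : set L) (m : L),
    supremums T m -> point_filter x m -> point_filter x `&` T !=set0.
Proof.
split=> [hc x T m /hc/supremums_setP|hc T m supTm].
  by rewrite /point_filter /= => -> [_ [a Ta <-] hax]; exists a.
apply/supremums_setP/seteqP; split=> x.
  by move=> /(hc _ _ _ supTm)[a [hax Ta]]; exists (h a) => //; exists a.
by move=> [_ [a Ta <-]]; apply: hom_subset; exact: supTm.1.
Qed.

(** Irredundancy at [x] makes the filter nonempty, and [x] lying outside [h \bot] makes it proper;
    the rest holds because [h] is a lattice morphism. *)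
Lemma prime_point_filter (x : X) :
  (exists a, h a x) -> ~ h \bot%O x -> prime_filter (point_filter x).
Proof.
move=> hx h0x; split.
- split=> // [a b hax ab|a b hax hbx]; first exact: hom_subset ab _ hax.
  by rewrite /point_filter /= omorphI.
- by move=> FT; apply: h0x; have : point_filter x \bot%O by rewrite FT.
- by move=> a b; rewrite /point_filter /= omorphU.
Qed.

End PointFilter.

Section FilterRepresentation.
Context {d : Order.disp_t} {L : tbDistrLatticeType d}.
Variable S : set (set L).
Hypothesis S_prime : forall F, S F -> prime_filter F.

Definition filter_hom (a : L) : set {F : set L | S F} := [set F | sval F a].

Lemma filter_homI : {morph filter_hom : a b / (a `&` b)%O}.
Proof.
move=> a b; apply/seteqP; split=> -[F SF] /=;
  have [[_ upF meetF] _ _] := S_prime SF.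
- by rewrite /filter_hom /= => Fab; split; apply: upF Fab _;
    rewrite ?leIl ?leIr.
- by move=> [Fa Fb]; exact: meetF.
Qed.

(** Primality gives the inclusion from left to right, upward closure the other one. *)
Lemma filter_homU : {morph filter_hom : a b / (a `|` b)%O}.
Proof.
move=> a b; apply/seteqP; split=> -[F SF] /=;
  have [[_ upF _] _ primeF] := S_prime SF.
- exact: primeF.
- by move=> [Fa|Fb]; [apply: upF Fa _|apply: upF Fb _]; rewrite ?leUl ?leUr.
Qed.

Lemma filter_hom_le : {homo filter_hom : a b / (a <= b)%O}.
Proof. by move=> a b /meet_idPl ab; apply/meet_idPl; rewrite -filter_homI ab. Qed.

End FilterRepresentation.

(** The predicate [P] stands for any condition on filters, so that all three equivalences become
    instances. It transfers both ways because the filters of one side are point filters of the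
    other. *)
Lemma representation_filtersP (d : Order.disp_t) (L : tbDistrLatticeType d)
    (P : set L -> Prop) :
  (exists (X : Type) (h : {lmorphism L -> set X}),
    representation h /\ forall x, P (point_filter h x)) <->
  (exists S : set (set L), distinguishing S /\
    forall F, S F -> prime_filter F /\ P F).
Proof.
split=> [[X [h [[inj_h irr_h] Ph]]]|[S [distS SP]]].
  (* [h \bot] may be inhabited; its points lie in every [h a], hence separate
     nothing, and their improper filters can be discarded. *)
  exists [set point_filter h x | x in ~` h \bot%O]; split.
    have sep b x : ~ h b x ->
        [set point_filter h x | x in ~` h \bot%O] (point_filter h x).
      move=> hbx; exists x => // h0x; apply: hbx.
      exact: hom_subset (le0x b) _ h0x.
    (* If no such filter separated [a] from [b], then [h a] and [h b] would have the same points,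
       and injectivity would give [a = b]. *)
    move=> a b ab; apply: contrapT => nsep; apply: ab; apply: inj_h.
    apply/seteqP; split=> x hx; apply: contrapT => nhx; apply: nsep;
      exists (point_filter h x); try exact: sep nhx.
      by left.
    by right.
  by move=> _ [x h0x <-]; split; [exact: prime_point_filter|exact: Ph].
have S_prime F : S F -> prime_filter F by move=> /SP[].
pose f := @filter_hom _ _ S.
pose fO := Order.isOrderMorphism.Build _ _ _ _ f (filter_hom_le S_prime).
pose fI := Order.isMeetLatticeMorphism.Build _ _ _ _ f (filter_homI S_prime).
pose fU := Order.isJoinLatticeMorphism.Build _ _ _ _ f (filter_homU S_prime).
pose h : {lmorphism L -> set {F : set L | S F}} := HB.pack f fO fI fU.
(* The point filter of [h] at a member [F] of [S] is [F] itself by conversion, so [P] carries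
   over. *)
exists {F : set L | S F}, h; split; last by case=> F SF; have [] := SP F SF.
split=> [a b hab|[F SF]]; last first.
  by have [[[a Fa] _ _] _ _] := S_prime F SF; exists a.
(* A member of [S] separating [a] from [b] is a point on which [h a] and [h b] differ, contrary to
   [hab]. *)
apply: contrapT => /distS[F SF].
have : sval (exist S F SF) a = sval (exist S F SF) b.
  exact: (congr1 (fun A : set _ => A (exist S F SF)) hab).
by move=> /= ->; tauto.
Qed.

Theorem theorem2p10 (d : Order.disp_t) (L : tbDistrLatticeType d) :
  [/\ has_meet_complete_representation L <->
        (exists S : set (set L), distinguishing S /\
           (forall F, S F -> complete_filter F /\ prime_filter F)),
      has_join_complete_representation L <->
        (exists S : set (set L), distinguishing S /\
           (forall F, S F -> completely_prime_filter F))
    & has_complete_representation L <->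
        (exists S : set (set L), distinguishing S /\
           (forall F, S F -> complete_filter F /\ completely_prime_filter F))].
Proof.
(* Only the bare closure conditions take the place of [P]; primality is supplied by
   [representation_filtersP]. *)
pose meetP (F : set L) :=
  forall (T : set L) (m : L), T `<=` F -> infimums T m -> F m.
pose joinP (F : set L) :=
  forall (T : set L) (m : L), supremums T m -> F m -> F `&` T !=set0.
split.
- split=> [[X [h [rh /meet_completeP hc]]]|[S [distS SP]]].
    have [|S [distS SP]] := (representation_filtersP meetP).1.
      by exists X, h.
    (* The filter axioms inside [complete_filter] are read off from primality. *)
    by exists S; split=> // F /SP[pF]; split=> //; split=> //; case: pF.
  have [|X [h [rh hc]]] := (representation_filtersP meetP).2.
    by exists S; split=> // F /SP[[_ cF] pF].
  by exists X, h; split=> //; apply/meet_completeP.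
- split=> [[X [h [rh /join_completeP hc]]]|].
    (* [completely_prime_filter] unfolds to primality together with [joinP], so the equivalence
       applies by conversion. *)
    by apply/(representation_filtersP joinP); exists X, h.
  move=> /(representation_filtersP joinP)[X [h [rh hc]]].
  by exists X, h; split=> //; apply/join_completeP.
- split=> [[X [h [rh [/meet_completeP hm /join_completeP hj]]]]|[S [distS SP]]].
    (* Both conditions are imposed at once on the same filters, so that a single family serves for
       meets and joins together. *)
    have [|S [distS SP]] :=
        (representation_filtersP (fun F => meetP F /\ joinP F)).1.
      by exists X, h; split=> // x; split; [exact: hm|exact: hj].
    exists S; split=> // F /SP[pF [mF jF]]; split; split=> //.
    by case: pF.
  have [|X [h [rh hc]]] :=
      (representation_filtersP (fun F => meetP F /\ joinP F)).2.
    by exists S; split=> // F /SP[[_ mF] [pF jF]].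
  exists X, h; split=> //; split.
    by apply/meet_completeP => x; case: (hc x).
  by apply/join_completeP => x; case: (hc x).
Qed.
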